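(* The functorial insertion $K:\mathbf{Comm}\to\mathbf{Ver}$ of the category of commutative rings into the category of vertex rings has a right adjoint $C:\mathbf{Ver}\to\mathbf{Comm}$. Here $C$ is the center functor $V\mapsto C(V)$ that assigns to each vertex ring $V$ its center $C(V)$ (a commutative ring under the product $(u,v)\mapsto u(-1)v$, with identity the vacuum $\mathbf{1}$) and to each morphism its restriction to centers.
   Context: A vertex ring is an additive abelian group $V$ with biadditive products $u(n)v$ for all $n\in\mathbf{Z}$ and a distinguished element $\mathbf{1}\in V$ (the vacuum) such that for all $u,v,w\in V$: (a) there is an integer $n_0(u,v)\ge 0$ with $u(n)v=0$ for all $n\ge n_0$; (b) $u(-1)\mathbf{1}=u$ and $u(n)\mathbf{1}=0$ for $n\ge 0$; (c) for all $r,s,t\in\mathbf{Z}$, $\sum_{i\ge 0}\binom{r}{i}(u(t+i)v)(r+s-i)w=\sum_{i\ge 0}(-1)^i\binom{t}{i}\{u(r+t-i)v(s+i)w-(-1)^t v(s+t-i)u(r+i)w\}$. Here $\binom{m}{n}=m(m-1)\cdots(m-n+1)/n!$ for $m\in\mathbf{Z}$, $n\ge 1$, and $\binom{m}{0}=1$. A morphism $f:U\to V$ of vertex rings is an additive map with $f(u(n)v)=f(u)(n)f(v)$ for all $u,v\in U$, $n\in\mathbf{Z}$, and $f(\mathbf{1})=\mathbf{1}$. $\mathbf{Ver}$ is the category of vertex rings and these morphisms; $\mathbf{Comm}$ is the category of unital commutative associative rings and unital ring morphisms. The functor $K$ sends a commutative ring $A$ to $A$ regarded as a vertex ring with vacuum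 $1$, $u(-1)v=uv$ and $u(n)v=0$ for $n\ne -1$, and is the identity on underlying maps. The center $C(V)$ is the set of $u\in V$ such that $u(n)v=0$ for all $v\in V$ and all $n\ne -1$. *)

(* Defs.v *)
From HB Require Import structures.
From mathcomp Require Import all_boot all_order all_algebra finmap.
From mathcomp Require Import boolp classical_sets functions cardinality fsbigop.
From mathcomp Require Import zify ring.

Set Implicit Arguments.
Unset Strict Implicit.
Unset Printing Implicit Defensive.

Import GRing.Theory.
Local Open Scope ring_scope.

(* The division is exact (binz_nat, binz_neg); the empty product gives
   binz m 0 = 1. *)
Definition binz (m : int) (n : nat) : int :=
  ((\prod_(i < n) (m - i%:Z)) %/ (n`!)%:Z)%Z.

Lemma binz_nat (m n : nat) : binz m n = 'C(m, n)%:Z.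
Proof.
rewrite /binz.
have -> : \prod_(i < n) (m%:Z - i%:Z) = (m ^_ n)%:Z.
  elim: n => [|n IHn]; first by rewrite big_ord0.
  rewrite big_ord_recr /= IHn ffactnSr.
  have [le_nm|lt_mn] := leqP n m; first by rewrite subzn.
  by rewrite ffact_small // mul0r mul0n.
by rewrite -bin_ffact PoszM mulzK // eqz_nat -lt0n fact_gt0.
Qed.

Lemma binz_neg (m n : nat) :
  binz (- (m.+1)%:Z) n = (-1) ^+ n * 'C(m + n, n)%:Z.
Proof.
rewrite /binz.
have -> : \prod_(i < n) (- (m.+1)%:Z - i%:Z) = (-1) ^+ n * ((m + n) ^_ n)%:Z.
  elim: n => [|n IHn]; first by rewrite big_ord0.
  rewrite big_ord_recr /= IHn addnS ffactnS /= PoszM exprS.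
  have -> : - (m.+1)%:Z - n%:Z = - ((m + n).+1)%:Z by lia.
  by ring.
by rewrite -bin_ffact PoszM mulrA mulzK // eqz_nat -lt0n fact_gt0.
Qed.

(* [vmul n u v] is u(n)v.  The sums over i >= 0 are the library's sums of
   finitely supported families; finiteness of the supports follows from
   [vmul_trunc]. *)
HB.mixin Record isVertexRing V of GRing.Zmodule V := {
  vmul : int -> V -> V -> V;
  vac : V;
  vmulDl : forall n, left_distributive (vmul n) +%R;
  vmulDr : forall n, right_distributive (vmul n) +%R;
  vmul_trunc : forall u v, exists n0 : nat,
    forall n : int, n0%:Z <= n -> vmul n u v = 0;
  vmulN1_vac : forall u, vmul (-1) u vac = u;
  vmul_nat_vac : forall u (n : int), 0 <= n -> vmul n u vac = 0;
  vjacobi : forall (u v w : V) (r s t : int),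
    \sum_(i \in [set: nat]%classic)
      vmul (r + s - i%:Z) (vmul (t + i%:Z) u v) w *~ binz r i =
    \sum_(i \in [set: nat]%classic)
      (vmul (r + t - i%:Z) u (vmul (s + i%:Z) v w)
       - vmul (s + t - i%:Z) v (vmul (r + i%:Z) u w) *~ ((-1) ^ t))
        *~ ((-1) ^+ i * binz t i)
}.

#[short(type="vertexRingType")]
HB.structure Definition VertexRing := {V of isVertexRing V & GRing.Zmodule V}.

Notation "u *_( n ) v" := (vmul n u v)
  (at level 40, left associativity, format "u  *_( n )  v") : ring_scope.

HB.mixin Record isVertexMorphism (U V : vertexRingType) (f : U -> V) := {
  vmorphM : forall n (u v : U), f (u *_(n) v) = f u *_(n) f v;
  vmorph1 : f vac = vac
}.

HB.structure Definition VertexMorphism (U V : vertexRingType) :=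
  {f of @GRing.isNmodMorphism U V f & isVertexMorphism U V f}.

Notation "{ 'vmorphism' U -> V }" := (VertexMorphism.type U%type V%type)
  (at level 0, U at level 98, V at level 99,
   format "{ 'vmorphism'  U  ->  V }") : type_scope.

Lemma sum_trunc (V : zmodType) (N : nat) (F : nat -> V) :
  (forall i, (N <= i)%N -> F i = 0) ->
  \sum_(i \in [set: nat]%classic) F i = \sum_(i < N) F i.
Proof.
move=> F0; rewrite -(big_mkord xpredT F) /index_iota subn0.
rewrite (@fsbigTE _ _ _ _ [fset i in iota 0 N]%fset); last first.
  by move=> i; rewrite !inE mem_iota /= -leqNgt; exact: F0.
apply: perm_big; apply: uniq_perm; rewrite ?fset_uniq ?iota_uniq // => i.
by rewrite inE.
Qed.

Lemma sum_ord_pick (V : zmodType) (N : nat) (k : int) (F : nat -> V) :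
  k < N%:Z -> (forall i : nat, i%:Z != k -> F i = 0) ->
  \sum_(i < N) F i = if k is Posz n then F n else 0.
Proof.
case: k => [n|n] lt_nN F0; last by rewrite big1 // => i _; apply: F0.
have nN : (n < N)%N by rewrite -ltz_nat.
rewrite (bigD1 (Ordinal nN)) //= big1 ?addr0 // => i /eqP ni.
by apply: F0; apply: contra_not_neq ni => -[e]; apply: val_inj.
Qed.

Lemma sum_head (V : zmodType) (F : nat -> V) :
  (forall i, (0 < i)%N -> F i = 0) ->
  \sum_(i \in [set: nat]%classic) F i = F 0%N.
Proof. by move=> F0; rewrite (sum_trunc F0) big_ord1. Qed.

Section VertexRingTheory.
Variable V : vertexRingType.
Implicit Types (u v w : V) (m n r s t : int).

Lemma vmul_zmod_morphisml n v : zmod_morphism (fun u => u *_(n) v).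
Proof.
move=> u w /=; apply: (addIr (w *_(n) v)).
by rewrite -vmulDl !subrK.
Qed.

Lemma vmul_zmod_morphismr n u : zmod_morphism (vmul n u).
Proof.
move=> v w /=; apply: (addIr (u *_(n) w)).
by rewrite -vmulDr !subrK.
Qed.

Lemma vmul0 n u : u *_(n) 0 = 0.
Proof. by rewrite -[X in _ *_(n) X](subrr u) vmul_zmod_morphismr subrr. Qed.

Lemma v0mul n v : 0 *_(n) v = 0.
Proof. by rewrite -[X in X *_(n) _](subrr v) vmul_zmod_morphisml subrr. Qed.

Lemma vassoc t s u v w :
  (u *_(t) v) *_(s) w =
  \sum_(i \in [set: nat]%classic)
    (u *_(t - i%:Z) (v *_(s + i%:Z) w)
     - v *_(s + t - i%:Z) (u *_(i%:Z) w) *~ ((-1) ^ t))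
      *~ ((-1) ^+ i * binz t i).
Proof.
have := vjacobi u v w 0 s t.
rewrite sum_head => [|i i_gt0]; last by rewrite binz_nat bin_small // mulr0z.
rewrite binz_nat bin0 !addr0 add0r ?subr0 mulr1z => ->.
by apply: eq_fsbigr => i _; rewrite !add0r.
Qed.

Lemma vcomm r s u v w :
  \sum_(i \in [set: nat]%classic)
     (u *_(i%:Z) v) *_(r + s - i%:Z) w *~ binz r i =
  u *_(r) (v *_(s) w) - v *_(s) (u *_(r) w).
Proof.
have := vjacobi u v w r s 0.
rewrite [RHS]sum_head => [|i i_gt0]; last first.
  by rewrite binz_nat bin_small // mulr0 mulr0z.
rewrite binz_nat bin0 expr0z !addr0 ?subr0 mulr1z => <-.
by apply: eq_fsbigr => i _; rewrite !add0r.
Qed.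

Lemma vassocN1 s u v w (N : nat) :
  (forall i : nat, (N <= i)%N -> v *_(s + i%:Z) w = 0) ->
  (forall i : nat, (N <= i)%N -> u *_(i%:Z) w = 0) ->
  (u *_(-1) v) *_(s) w =
  \sum_(i < N) (u *_(-1 - i%:Z) (v *_(s + i%:Z) w)
                + v *_(s - 1 - i%:Z) (u *_(i%:Z) w)).
Proof.
move=> v0 u0; rewrite vassoc (@sum_trunc _ N) => [|i leNi]; last first.
  by rewrite v0 // u0 // !vmul0 mul0rz subrr mul0rz.
apply: eq_bigr => i _.
rewrite (binz_neg 0) add0n binn mulr1.
by rewrite -exprD addnn -mul2n exprM sqrrN !expr1n mulr1z mulrNz mulr1z opprK.
Qed.

Lemma vac_nat n u : 0 <= n -> vac *_(n) u = 0.
Proof.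
move=> n_ge0; have := vcomm (-1) n u vac vac.
rewrite sum_head => [|i _]; last by rewrite (vmul_nat_vac u) // v0mul mul0rz.
rewrite (vmul_nat_vac u) // v0mul mul0rz (vmul_nat_vac vac) // vmul0 vmulN1_vac sub0r.
by move/esym/eqP; rewrite oppr_eq0 => /eqP.
Qed.

Lemma vacN1 u : vac *_(-1) u = u.
Proof.
have := vcomm (-1) (-1) u vac vac.
rewrite sum_head => [|i _]; last by rewrite (vmul_nat_vac u) // v0mul mul0rz.
rewrite (vmul_nat_vac u) // v0mul mul0rz !vmulN1_vac.
by move/esym/eqP; rewrite subr_eq0 => /eqP.
Qed.

Lemma vac_neg (k : nat) u : vac *_(- (k.+2)%:Z) u = 0.
Proof.
elim/ltn_ind: k u => k IHk u.
have := @vassocN1 (- (k.+2)%:Z) vac vac u k.+2.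
rewrite vmulN1_vac big_ord_recl big_ord_recr /= big1 => [|i _]; last first.
  rewrite (@vac_nat (bump 0 (widen_ord (leqnSn k) i))%:Z) // vmul0 addr0.
  have -> : - (k.+2)%:Z + (bump 0 (widen_ord (leqnSn k) i))%:Z
            = - ((k - i.+1).+2)%:Z.
    by have := ltn_ord i; rewrite /bump /=; lia.
  by rewrite IHk ?vmul0 //; have := ltn_ord i; lia.
rewrite (@vac_nat 0%Z) // (@vac_nat (bump 0 k)%:Z) // !vmul0 !addr0 add0r.
have -> : -1 - (bump 0 k)%:Z = - (k.+2)%:Z by rewrite /bump; lia.
have -> : - (k.+2)%:Z + (bump 0 k)%:Z = -1 by rewrite /bump; lia.
rewrite ?subr0 !vacN1 => e.
have {}e : vac *_(- (k.+2)%:Z) u = vac *_(- (k.+2)%:Z) u + vac *_(- (k.+2)%:Z) u.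
  by apply: e => i le_ki; apply: vac_nat => //; lia.
by apply: (addIr (vac *_(- (k.+2)%:Z) u)); rewrite -e add0r.
Qed.

Lemma vacE n u : n != -1 -> vac *_(n) u = 0.
Proof.
move=> n_neq; have [n_ge0|] := boolP (0 <= n); first exact: vac_nat.
move=> n_lt0; have -> : n = - ((`|n| - 2).+2)%:Z by lia.
exact: vac_neg.
Qed.

End VertexRingTheory.

Definition center (V : vertexRingType) : {pred V} :=
  [pred u | `[< forall (v : V) (n : int), n != -1 -> u *_(n) v = 0 >]].
Arguments center : clear implicits.

Section CenterTheory.
Variable V : vertexRingType.
Implicit Types (u v w : V) (n : int).

Lemma centerP u :
  reflect (forall v n, n != -1 -> u *_(n) v = 0) (u \in center V).
Proof. exact: asboolP. Qed.

Lemma vac_center : vac \in center V.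
Proof. by apply/centerP => v n n_neq; rewrite vacE. Qed.

Lemma center_zmod_closed : zmod_closed (center V).
Proof.
split; first by apply/centerP => v n _; rewrite v0mul.
move=> u v /centerP uC /centerP vC; apply/centerP => w n n_neq.
by rewrite vmul_zmod_morphisml uC // vC // subrr.
Qed.

Lemma center_assoc n u v w : u \in center V ->
  (u *_(-1) v) *_(n) w = u *_(-1) (v *_(n) w).
Proof.
move=> /centerP uC; have [N vN] := vmul_trunc v w.
rewrite (@vassocN1 _ _ _ _ _ (`|N%:Z - n|.+1)); last 2 first.
- by move=> i le_i; apply: vN; lia.
- by move=> i _; apply: uC.
rewrite big_ord_recl big1 => [|i _].
  by rewrite (uC w) // vmul0 !addr0 ?subr0.
by rewrite (uC w) // uC ?vmul0 ?addr0 // lift0; lia.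
Qed.

Lemma vmulN1_center u v :
  u \in center V -> v \in center V -> u *_(-1) v \in center V.
Proof.
move=> uC /centerP vC; apply/centerP => w n n_neq.
by rewrite center_assoc // vC // vmul0.
Qed.

Lemma vmulN1C u v : u \in center V -> u *_(-1) v = v *_(-1) u.
Proof.
move=> /centerP uC; have := vcomm (-1) (-1) u v vac.
rewrite fsbig1 => [|i _]; last by rewrite uC // v0mul mul0rz.
by rewrite !vmulN1_vac => /esym/eqP; rewrite subr_eq0 => /eqP.
Qed.

Lemma mulrn_bin0 (M : zmodType) (x : M) (N n : nat) :
  (forall m, (N < m)%N -> x *+ 'C(m, n) = 0) -> x = 0.
Proof.
elim: n => [|n IHn] x0; first by have := x0 N.+1 (leqnn _); rewrite bin0.
apply: IHn => m lt_Nm; have := x0 m.+1 (ltnW lt_Nm).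
by rewrite binS mulrnDr x0 // add0r.
Qed.

(* Membership in the center can be tested against the vacuum alone; this is
   what makes the center functorial for all morphisms, surjective or not. *)
Lemma center_vac u :
  (forall m : nat, u *_(- (m.+2)%:Z) vac = 0) -> u \in center V.
Proof.
move=> u0; apply/centerP => w n n_neq.
have [n_ge0|n_lt0] := boolP (0 <= n); last first.
  have [m -> {n n_neq n_lt0}] : exists m : nat, n = - (m.+2)%:Z.
    by exists (`|n| - 2)%N; lia.
  have := vassoc (- (m.+2)%:Z) (-1) u vac w.
  rewrite u0 v0mul sum_head => [|i i_gt0].
    rewrite addr0 ?subr0 vacN1 vacE ?mul0rz; last by lia.
    by rewrite subr0 expr0 mul1r {1}/binz big_ord0 /= mulr1z => <-.
  rewrite vacE ?vmul0; last by lia.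
  by rewrite vacE ?mul0rz ?subrr ?mul0rz //; lia.
case: n n_ge0 n_neq => // n _ _.
apply: (@mulrn_bin0 _ _ n n) => m' lt_nm'.
have [m -> {m' lt_nm'}] : exists m, m' = (m.+1 + n)%N.
  by exists (m' - n.+1)%N; lia.
have := vassoc (- (m.+2)%:Z) (n%:Z + (m.+1)%:Z) u vac w.
have F0 i : i%:Z != n%:Z ->
  (u *_(- (m.+2)%:Z - i%:Z) (vac *_(n%:Z + (m.+1)%:Z + i%:Z) w)
   - vac *_(n%:Z + (m.+1)%:Z + - (m.+2)%:Z - i%:Z) (u *_(i%:Z) w)
       *~ ((-1) ^ - (m.+2)%:Z)) *~ ((-1) ^+ i * binz (- (m.+2)%:Z) i) = 0.
  move=> ne_in; rewrite (@vacE _ _ w); last by lia.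
  by rewrite vmul0 vacE ?mul0rz ?subrr ?mul0rz //; lia.
rewrite u0 v0mul (@sum_trunc _ n.+1) => [|i lt_ni]; last by apply: F0; lia.
rewrite (sum_ord_pick _ F0) ?ltz_nat // (@vacE _ _ w); last by lia.
have -> : n%:Z + (m.+1)%:Z + - (m.+2)%:Z - n%:Z = -1 by lia.
rewrite vmul0 sub0r vacN1 binz_neg mulrA -exprD addnn -mul2n exprM sqrrN.
rewrite !expr1n mul1r -mulNrz -mulrzA mulrC mulrzA => /esym.
rewrite -exprz_inv invrN1 -exprnP -signr_odd mulNrz.
by case: (odd _); rewrite ?expr0 ?expr1 ?mulr1z ?mulrNz ?mulr1z => /eqP;
  rewrite ?opprK ?oppr_eq0 => /eqP.
Qed.

Lemma center_vacP u :
  reflect (forall m : nat, u *_(- (m.+2)%:Z) vac = 0) (u \in center V).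
Proof.
apply: (iffP idP) => [/centerP uC m|]; last exact: center_vac.
by apply: uC; lia.
Qed.

End CenterTheory.

Lemma vmorph_center (U V : vertexRingType) (f : {vmorphism U -> V}) u :
  u \in center U -> f u \in center V.
Proof.
move=> /centerP uC; apply: center_vac => m.
by rewrite -(@vmorph1 _ _ f) -vmorphM uC ?raddf0 //; lia.
Qed.

Record center_ring (V : vertexRingType) :=
  CenterRing { center_val : V; _ : center_val \in center V }.
Arguments CenterRing {V} center_val _.

Section CenterRing.
Variable V : vertexRingType.
Implicit Types u v w : center_ring V.

HB.instance Definition _ := [isSub for @center_val V].
HB.instance Definition _ := [Choice of center_ring V by <:].
HB.instance Definition _ :=
  GRing.isZmodClosed.Build V (center V) (@center_zmod_closed V).
HB.instance Definition _ :=
  [SubChoice_isSubZmodule of center_ring V by <:].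

Definition center_one : center_ring V := CenterRing vac (@vac_center V).
Definition center_mul u v : center_ring V :=
  CenterRing (val u *_(-1) val v) (vmulN1_center (valP u) (valP v)).

Lemma center_mulA : associative center_mul.
Proof.
by move=> u v w; apply: val_inj; rewrite /= center_assoc ?(valP u).
Qed.

Lemma center_mulC : commutative center_mul.
Proof. by move=> u v; apply: val_inj; rewrite /= vmulN1C ?(valP u). Qed.

Lemma center_mul1 : left_id center_one center_mul.
Proof. by move=> u; apply: val_inj; rewrite /= vacN1. Qed.

Lemma center_mulDl : left_distributive center_mul +%R.
Proof. by move=> u v w; apply: val_inj; rewrite /= vmulDl. Qed.

HB.instance Definition _ := GRing.Zmodule_isComPzRing.Build (center_ring V)
  center_mulA center_mulC center_mul1 center_mulDl.

End CenterRing.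

Section CenterMap.
Variables (U V : vertexRingType) (f : {vmorphism U -> V}).

Definition center_map (u : center_ring U) : center_ring V :=
  CenterRing (f (val u)) (vmorph_center f (valP u)).

Lemma center_map_nmod : nmod_morphism center_map.
Proof.
split; first by apply: val_inj; rewrite /= raddf0.
by move=> u v; apply: val_inj; rewrite /= raddfD.
Qed.

Lemma center_map_monoid : monoid_morphism center_map.
Proof.
split; first by apply: val_inj; rewrite /= vmorph1.
by move=> u v; apply: val_inj; rewrite /= vmorphM.
Qed.

HB.instance Definition _ :=
  GRing.isNmodMorphism.Build _ _ center_map center_map_nmod.
HB.instance Definition _ :=
  GRing.isMonoidMorphism.Build _ _ center_map center_map_monoid.

End CenterMap.

Definition vertex_of (A : comPzRingType) : Type := A.

Section VertexOf.
Variable A : comPzRingType.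
Implicit Types (u v w : vertex_of A) (n r s t : int).

HB.instance Definition _ := GRing.Zmodule.on (vertex_of A).

Definition ring_vmul n u v : vertex_of A :=
  if n == -1 then (u : A) * (v : A) else 0.

Lemma ring_vmulDl n : left_distributive (ring_vmul n) +%R.
Proof.
by move=> u v w; rewrite /ring_vmul; case: ifP => _; rewrite ?addr0 ?mulrDl.
Qed.

Lemma ring_vmulDr n : right_distributive (ring_vmul n) +%R.
Proof.
by move=> u v w; rewrite /ring_vmul; case: ifP => _; rewrite ?addr0 ?mulrDr.
Qed.

Lemma ring_vmul_trunc u v : exists n0 : nat,
  forall n : int, n0%:Z <= n -> ring_vmul n u v = 0.
Proof. by exists 0%N => n n_ge0; rewrite /ring_vmul ifF //; lia. Qed.

Lemma ring_vmulN1_vac u : ring_vmul (-1) u 1 = u.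
Proof. by rewrite /ring_vmul eqxx mulr1. Qed.

Lemma ring_vmul_nat_vac u n : 0 <= n -> ring_vmul n u 1 = 0.
Proof. by move=> n_ge0; rewrite /ring_vmul ifF //; lia. Qed.

Lemma ring_vmul_nest1 r n u v w :
  ring_vmul r (ring_vmul n u v) w =
  (if (r == -1) && (n == -1) then (u : A) * (v : A) * (w : A) else 0).
Proof.
by rewrite /ring_vmul; case: (r == -1); case: (n == -1); rewrite ?mul0r.
Qed.

Lemma ring_vmul_nest2 r n u v w :
  ring_vmul r u (ring_vmul n v w) =
  (if (r == -1) && (n == -1) then (u : A) * (v : A) * (w : A) else 0).
Proof.
rewrite /ring_vmul; case: (r == -1); case: (n == -1); rewrite ?mulr0 //.
exact: mulrA.
Qed.

(* binz, extended by 0 to negative lower arguments *)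
Definition binzz (m k : int) : int := if k is Posz n then binz m n else 0.

Lemma ring_binz r s t : r + s + t = -2 ->
  binzz r (-1 - t) =
  (-1) ^ (-1 - s) * binzz t (-1 - s)
  - (-1) ^ (-1 - r) * (-1) ^ t * binzz t (-1 - r).
Proof.
have Nn (n : nat) : -1 - Negz n = n%:Z by lia.
have Np (n : nat) : -1 - n%:Z = Negz n by lia.
have sq (n : nat) : (-1) ^+ n * (-1) ^+ n = 1 :> int.
  by rewrite -exprD addnn -mul2n exprM sqrrN !expr1n.
have binD (m n : nat) : 'C(m + n, m) = 'C(m + n, n).
  by rewrite -(bin_sub (leq_addr n m)) addKn.
case: r => a; case: s => b; case: t => c; rewrite ?Nn ?Np /= => rst.
- by lia.
- by rewrite binz_nat bin_small ?mulr0 ?subr0 //; lia.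
- by rewrite binz_nat bin_small ?mulr0 ?subr0 //; lia.
- have -> : a = (b + c)%N by lia.
  by rewrite mulr0 subr0 NegzE binz_neg binz_nat mulrA sq mul1r addnC binD.
- by rewrite binz_nat bin_small ?mulr0 ?subr0 //; lia.
- rewrite mulr0 sub0r !NegzE !binz_neg -exprz_inv invrN1.
  rewrite -!exprnP exprS mulrACA mulrA mulrA.
  have -> : 'C(c + a, a) = 'C(a + c, c).
    by rewrite -binD addnC.
  by rewrite sq mul1r mulN1r mulNr opprK.
- have -> : c = (a + b)%N by lia.
  rewrite !binz_nat -[in RHS]exprnP -!exprnP exprD mulrA sq mul1r.
  by rewrite binD subrr.
- by lia.
Qed.

Lemma ring_vjacobi u v w r s t :
    \sum_(i \in [set: nat]%classic)
      ring_vmul (r + s - i%:Z) (ring_vmul (t + i%:Z) u v) w *~ binz r i =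
    \sum_(i \in [set: nat]%classic)
      (ring_vmul (r + t - i%:Z) u (ring_vmul (s + i%:Z) v w)
       - ring_vmul (s + t - i%:Z) v (ring_vmul (r + i%:Z) u w) *~ ((-1) ^ t))
        *~ ((-1) ^+ i * binz t i).
Proof.
set N := (`|r| + `|s| + `|t|).+1%N.
rewrite !(@sum_trunc _ N) => [|i le_Ni|i le_Ni]; first last.
- by rewrite ring_vmul_nest1 ifF ?mul0rz //; lia.
- rewrite !ring_vmul_nest2 ifF; last by lia.
  by rewrite ifF ?mul0rz ?subrr ?mul0rz //; lia.
have [rst|rst] := eqVneq (r + s + t) (-2); last first.
  rewrite !big1 // => i _.
    rewrite !ring_vmul_nest2 ifF; last by lia.
    by rewrite ifF ?mul0rz ?subrr ?mul0rz //; lia.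
  by rewrite ring_vmul_nest1 ifF ?mul0rz //; lia.
pose x : A := (u : A) * (v : A) * (w : A).
have pick (k m : int) (e : int -> int) : k < N%:Z ->
    \sum_(i < N) (if i%:Z == k then x *~ (e i * binz m i) else 0)
    = x *~ (e k * binzz m k).
  move=> lt_kN; rewrite (@sum_ord_pick _ _ k
    (fun i : nat => if i%:Z == k then x *~ (e i * binz m i) else 0)) //.
    by case: k lt_kN => [n|n] _; rewrite ?eqxx // mulr0 mulr0z.
  by move=> i /negbTE ->.
transitivity (x *~ (1 * binzz r (-1 - t))).
  rewrite -(pick _ _ (fun=> 1)); last by lia.
  apply: eq_bigr => i _; rewrite ring_vmul_nest1 mul1r.
  have -> : (r + s - i%:Z == -1) && (t + i%:Z == -1) = (i%:Z == -1 - t) by lia.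
  by case: ifP; rewrite ?mul0rz.
rewrite mul1r (ring_binz rst) mulrzBr.
rewrite -(pick _ _ (fun k => (-1) ^ k)); last by lia.
rewrite -(pick _ _ (fun k => (-1) ^ k * (-1) ^ t)); last by lia.
rewrite -sumrB; apply: eq_bigr => i _; rewrite !ring_vmul_nest2.
have -> : (r + t - i%:Z == -1) && (s + i%:Z == -1) = (i%:Z == -1 - s) by lia.
have -> : (s + t - i%:Z == -1) && (r + i%:Z == -1) = (i%:Z == -1 - r) by lia.
rewrite mulrzBl; congr (_ - _); case: ifP => _; rewrite ?mul0rz //.
rewrite -mulrzA -/x; congr (_ *~ _); last by rewrite -exprnP; ring.
by rewrite /x (mulrC (v : A)).
Qed.

HB.instance Definition _ := isVertexRing.Build (vertex_of A)
  ring_vmulDl ring_vmulDr ring_vmul_trunc ring_vmulN1_vac ring_vmul_nat_vac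
  ring_vjacobi.

End VertexOf.

Section VertexMap.
Variables (A B : comPzRingType) (f : {rmorphism A -> B}).

Definition vertex_map : vertex_of A -> vertex_of B := f.

Lemma vertex_map_nmod : nmod_morphism vertex_map.
Proof. by split; [exact: raddf0 | exact: raddfD]. Qed.

Lemma vertex_mapM n (u v : vertex_of A) :
  vertex_map (u *_(n) v) = vertex_map u *_(n) vertex_map v.
Proof.
rewrite /vmul /= /ring_vmul /vertex_map; case: ifP => _; last exact: rmorph0.
exact: rmorphM.
Qed.

Lemma vertex_map1 : vertex_map vac = vac.
Proof. exact: rmorph1. Qed.

HB.instance Definition _ :=
  GRing.isNmodMorphism.Build _ _ vertex_map vertex_map_nmod.
HB.instance Definition _ :=
  isVertexMorphism.Build _ _ vertex_map vertex_mapM vertex_map1.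

End VertexMap.

Record category := Category {
  ob :> Type;
  hom : ob -> ob -> Type;
  idm : forall a, hom a a;
  comp : forall a b c, hom b c -> hom a b -> hom a c;
  comp1m : forall a b (f : hom a b), comp (idm b) f = f;
  compm1 : forall a b (f : hom a b), comp f (idm a) = f;
  compA : forall a b c d (h : hom c d) (g : hom b c) (f : hom a b),
    comp h (comp g f) = comp (comp h g) f
}.
Arguments hom {C} a b : rename.
Arguments idm {C} a : rename.
Arguments comp {C a b c} g f : rename.

Record functor (C D : category) := Functor {
  fob :> C -> D;
  fmap : forall a b : C, hom a b -> hom (fob a) (fob b);
  fmap1 : forall a : C, fmap (idm a) = idm (fob a);
  fmapM : forall (a b c : C) (g : hom b c) (f : hom a b),
    fmap (comp g f) = comp (fmap g) (fmap f)
}.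
Arguments fmap {C D} F {a b} f : rename.

(* G is right adjoint to F when there are bijections
   hom (F a) x ~ hom a (G x), natural in a and x. *)
Definition is_right_adjoint (C D : category) (F : functor C D)
    (G : functor D C) : Prop :=
  exists phi : forall (a : C) (x : D), hom (F a) x -> hom a (G x),
    [/\ forall a x, bijective (phi a x),
        forall (a b : C) (x : D) (f : hom a b) (g : hom (F b) x),
          phi a x (comp g (fmap F f)) = comp (phi b x g) f &
        forall (a : C) (x y : D) (h : hom x y) (g : hom (F a) x),
          phi a y (comp h g) = comp (fmap G h) (phi a x g)].

Lemma rmorph_eq (A B : comPzRingType) (f g : {rmorphism A -> B}) :
  f =1 g -> f = g.
Proof.
case: f g => [f [[f1] [f2]]] [g [[g1] [g2]]] /= /funext fg.
by subst g; rewrite (Prop_irrelevance f1 g1) (Prop_irrelevance f2 g2).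
Qed.

Definition Comm : category.
Proof.
refine (@Category comPzRingType (fun A B => {rmorphism A -> B})
  (fun A => (idfun : {rmorphism A -> A}))
  (fun A B C g f => (g \o f : {rmorphism A -> C})) _ _ _);
by move=> *; apply: rmorph_eq.
Defined.

Section VertexMorphismCategory.
Variables (U V W : vertexRingType).
Variables (f : {vmorphism U -> V}) (g : {vmorphism V -> W}).

Lemma id_vmorphM n (u v : U) : idfun (u *_(n) v) = idfun u *_(n) idfun v.
Proof. by []. Qed.

HB.instance Definition _ :=
  isVertexMorphism.Build U U idfun id_vmorphM (erefl vac).

Lemma comp_vmorphM n (u v : U) :
  (g \o f) (u *_(n) v) = (g \o f) u *_(n) (g \o f) v.
Proof. by rewrite /= !vmorphM. Qed.

Lemma comp_vmorph1 : (g \o f) vac = vac.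
Proof. by rewrite /= !vmorph1. Qed.

HB.instance Definition _ :=
  isVertexMorphism.Build U W (g \o f) comp_vmorphM comp_vmorph1.

End VertexMorphismCategory.

Lemma vmorph_eq (U V : vertexRingType) (f g : {vmorphism U -> V}) :
  f =1 g -> f = g.
Proof.
case: f g => [f [[f1] [f2 f3]]] [g [[g1] [g2 g3]]] /= /funext fg.
subst g; rewrite (Prop_irrelevance f1 g1) (Prop_irrelevance f2 g2).
by rewrite (Prop_irrelevance f3 g3).
Qed.

Definition Ver : category.
Proof.
refine (@Category vertexRingType (fun U V => {vmorphism U -> V})
  (fun U => (idfun : {vmorphism U -> U}))
  (fun U V W g f => (g \o f : {vmorphism U -> W})) _ _ _);
by move=> *; apply: vmorph_eq.
Defined.

Definition functor_K : functor Comm Ver.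
Proof.
refine (@Functor Comm Ver (fun A : comPzRingType => vertex_of A)
  (fun A B (f : {rmorphism A -> B}) =>
     (vertex_map f : {vmorphism vertex_of A -> vertex_of B})) _ _);
by move=> *; apply: vmorph_eq.
Defined.

Definition functor_C : functor Ver Comm.
Proof.
refine (@Functor Ver Comm (fun V : vertexRingType => center_ring V)
  (fun U V (f : {vmorphism U -> V}) =>
     (center_map f : {rmorphism center_ring U -> center_ring V})) _ _);
by move=> *; apply: rmorph_eq => u; apply: val_inj.
Defined.

(* Main.v *)
(* Every element of K(A) is central, and a morphism of vertex rings maps the
   center into the center, so a morphism K(A) -> V is the same thing as a ring
   morphism A -> C(V). *)
From HB Require Import structures.
From mathcomp Require Import all_boot all_algebra.
Require Import Defs.

Set Implicit Arguments.
Unset Strict Implicit.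
Unset Printing Implicit Defensive.

Import GRing.Theory.
Local Open Scope ring_scope.

Lemma vertex_of_center (A : comPzRingType) (u : vertex_of A) :
  u \in center (vertex_of A).
Proof.
by apply/centerP => v n n_neq; rewrite /vmul /= /ring_vmul (negbTE n_neq).
Qed.

Section Corestriction.
Variables (A : comPzRingType) (V : vertexRingType).
Variable g : {vmorphism vertex_of A -> V}.

Definition corestr (a : A) : center_ring V :=
  CenterRing (g a) (vmorph_center g (vertex_of_center a)).

Lemma corestr_nmod : nmod_morphism corestr.
Proof.
split; first by apply: val_inj; exact: (raddf0 g).
by move=> a b; apply: val_inj; exact: (raddfD g).
Qed.

Lemma corestr_monoid : monoid_morphism corestr.
Proof.
split; first by apply: val_inj; exact: (@vmorph1 _ _ g).
(* Both ring products are by construction the products of index -1. *)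
by move=> a b; apply: val_inj; exact: (@vmorphM _ _ g (-1) a b).
Qed.

HB.instance Definition _ := GRing.isNmodMorphism.Build _ _ corestr corestr_nmod.
HB.instance Definition _ :=
  GRing.isMonoidMorphism.Build _ _ corestr corestr_monoid.

End Corestriction.

Section Extension.
Variables (A : comPzRingType) (V : vertexRingType).
Variable h : {rmorphism A -> center_ring V}.

Definition center_ext (a : vertex_of A) : V := val (h a).

Lemma center_ext_nmod : nmod_morphism center_ext.
Proof.
by split=> [|a b]; rewrite /center_ext ?(raddf0 h) ?(raddfD h).
Qed.

(** For [n != -1] both sides vanish: the left because [vertex_of A] has no other products, the right
    because [h a] is central in [V]. *)
Lemma center_extM n (a b : vertex_of A) :
  center_ext (a *_(n) b) = center_ext a *_(n) center_ext b.
Proof.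
rewrite /center_ext {1}/vmul /= /ring_vmul.
have [->|n_neq] := eqVneq n (-1); first by rewrite (rmorphM h).
by rewrite (raddf0 h) (centerP _ (valP (h a))).
Qed.

Lemma center_ext1 : center_ext vac = vac.
Proof. by rewrite /center_ext (rmorph1 h). Qed.

HB.instance Definition _ :=
  GRing.isNmodMorphism.Build _ _ center_ext center_ext_nmod.
HB.instance Definition _ :=
  isVertexMorphism.Build _ _ center_ext center_extM center_ext1.

End Extension.

Theorem theorem6p5 : is_right_adjoint functor_K functor_C.
Proof.
exists (fun (A : comPzRingType) (V : vertexRingType)
  (g : {vmorphism vertex_of A -> V}) =>
  (corestr g : {rmorphism A -> center_ring V})).
split=> [A V|A B V f g|A U V h g].
- exists (fun h : {rmorphism A -> center_ring V} =>
    (center_ext h : {vmorphism vertex_of A -> V})) => [g|h].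
    (* The inclusion after [corestr g] computes to [g] on elements. *)
    exact: vmorph_eq.
  by apply: rmorph_eq => a; apply: val_inj.
- by apply: rmorph_eq => a; apply: val_inj.
- by apply: rmorph_eq => a; apply: val_inj.
Qed.
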